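(* Let $v=(e_1,\ldots,e_n)\in\{0,1\}^n$ ($n\ge1$) be a binary vector with exactly $m\ge1$ terms equal to $1$, located at positions $j_1<j_2<\cdots<j_m$. For each $k\in\{1,\ldots,m\}$ let $\theta_k(v),t_k(v)$ be positive integers with $3^k\theta_k(v)+1=2^{\,n-j_k+1}\,t_k(v)$, and put $$X^*(v)=\sum_{k=1}^m 2^{j_k-1}\theta_k(v),\qquad Y^*(v)=\sum_{k=1}^m 3^{m-k}t_k(v).$$ Then the Collatz sequence of first term $X^*(v)$ and length $n$ has $v$ as its parity vector, i.e. $v_n(X^*(v))=v$; the integers $\theta_1(v),\ldots,\theta_m(v)$ are all odd; and $T^{n}(X^*(v))=Y^*(v)$.
   Context: The Collatz map $T$ on positive integers is $T(N)=N/2$ if $N$ is even and $T(N)=(3N+1)/2$ if $N$ is odd. For an integer $N$ let $\mathbf{i}(N)=0$ if $N$ is even and $1$ if $N$ is odd, and for a positive integer $N$ put $v_n(N)=(\mathbf{i}(N),\mathbf{i}(T(N)),\ldots,\mathbf{i}(T^{n-1}(N)))$. *)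

(* Defs.v *)
From mathcomp Require Import all_boot.

Set Implicit Arguments.
Unset Strict Implicit.
Unset Printing Implicit Defensive.

(* The map is meant on positive integers, which it preserves; [collatz 0 = 0]
   is an irrelevant convention. *)
Definition collatz (N : nat) : nat :=
  if odd N then (3 * N + 1) %/ 2 else N %/ 2.

(* {0,1} is represented by [bool], so that [odd] is the parity indicator. *)
Definition parity_vector (n N : nat) : n.-tuple bool :=
  [tuple odd (iter i collatz N) | i < n].

(* Vector positions and the index k are 1-based, while [nth] is 0-based.
   Together the conditions say that j 1 < ... < j m are all the positions of
   the terms of v equal to 1; values of j outside [1, m] are ignored. *)
Definition ones_positions (n m : nat) (v : n.-tuple bool) (j : nat -> nat) :
    Prop :=
  [/\ count_mem true v = m,
      forall k, 1 <= k <= m -> 1 <= j k <= n /\ nth false v (j k - 1) = true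
    & forall k l, 1 <= k -> k < l -> l <= m -> j k < j l].

Definition Xstar (m : nat) (j theta : nat -> nat) : nat :=
  \sum_(1 <= k < m.+1) 2 ^ (j k - 1) * theta k.

Definition Ystar (m : nat) (t : nat -> nat) : nat :=
  \sum_(1 <= k < m.+1) 3 ^ (m - k) * t k.

(* Main.v *)
Require Import Defs.
From mathcomp Require Import all_boot.
From mathcomp Require Import zify.

(** The whole orbit of [Xstar] up to time [n] has a closed form.  Suppose that
    [p] of the first [i] entries of [v] are equal to 1.  Then
      T^i(X) =   sum over k <= p of 2^(n-i) 3^(p-k) t_k
               + sum over k > p  of 3^p 2^(j_k-1-i) theta_k.
    The k-th term starts as 2^(j_k-1) theta_k; it is halved at each step, and
    tripled at each odd step, until it becomes 3^(k-1) theta_k at time j_k - 1.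
    At that moment it is the only term that can be odd, and it absorbs the +1
    of the odd step: 3^k theta_k + 1 = 2^(n-j_k+1) t_k is the hypothesis on
    theta_k and t_k.  What remains is 2^(n-j_k) t_k, with just enough factors 2
    to stay even until time [n].

    So at a 0 of [v] all terms are even ([orbit_value_even]), and at a 1 the
    value triples, gains 1 and halves ([orbit_value_odd]), which forces it to
    be odd.  The induction [collatz_orbit] follows this from time 0, where the
    closed form is [Xstar], to time [n], where it is [Ystar].  The theta_k are
    odd because 3^k theta_k + 1 is even. *)

Definition orbit_value (n m : nat) (j theta t : nat -> nat) (i p : nat) : nat :=
  \sum_(1 <= k < p.+1) 2 ^ (n - i) * 3 ^ (p - k) * t k
  + \sum_(p.+1 <= k < m.+1) 3 ^ p * 2 ^ (j k - 1 - i) * theta k.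

Lemma collatz_even (N M : nat) : N = M.*2 -> collatz N = M.
Proof.
by move=> ->; rewrite /collatz odd_double -muln2 mulnK.
Qed.

Lemma odd_of_collatz_odd (N M : nat) : 3 * N + 1 = M.*2 -> odd N.
Proof. lia. Qed.

Lemma collatz_odd (N M : nat) : 3 * N + 1 = M.*2 -> collatz N = M.
Proof.
move=> e; rewrite /collatz (odd_of_collatz_odd _ _ e) e.
by rewrite -muln2 mulnK.
Qed.

(** Strict monotonicity makes [j] injective, so it lists [m] distinct ones of
    [v]; there are only [m], hence it misses none. *)
Lemma ones_positions_surj (n m : nat) (v : n.-tuple bool) (j : nat -> nat)
    (i : nat) :
  ones_positions m v j -> i < n -> nth false v i ->
  exists2 k, 1 <= k <= m & j k = i.+1.
Proof.
case=> cv jP jlt lin vi.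
set ones := [seq x <- iota 0 n | nth false v x].
set js := [seq j k - 1 | k <- iota 1 m].
have size_ones : size ones = m.
  rewrite size_filter -cv -[in RHS](mkseq_nth false v) size_tuple count_map.
  by apply: eq_count => x /=; rewrite eqb_id.
have js_uniq : uniq js.
  rewrite map_inj_in_uniq ?iota_uniq // => k l.
  rewrite !mem_iota => km lm e.
  have [|jk _] := jP k; first by lia.
  have [|jl _] := jP l; first by lia.
  case: (ltngtP k l) => // [kl|lk].
    by have : j k < j l by [apply: jlt; lia]; lia.
  by have : j l < j k by [apply: jlt; lia]; lia.
have js_sub : {subset js <= ones}.
  move=> x /mapP[k]; rewrite mem_iota => km ->.
  have [|jk vk] := jP k; first by lia.
  by rewrite mem_filter vk mem_iota; lia.
have [|_ same] := uniq_min_size js_uniq js_sub.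
  by rewrite size_ones size_map size_iota.
have : i \in js by rewrite same mem_filter vi mem_iota.
case/mapP=> k; rewrite mem_iota => km e.
exists k; first by lia.
by have [|jk _] := jP k; lia.
Qed.

Lemma orbit_value0 (n m : nat) (j theta t : nat -> nat) :
  orbit_value n m j theta t 0 0 = Xstar m j theta.
Proof.
rewrite /orbit_value big_geq // add0n.
by apply: eq_bigr => k _; rewrite expn0 mul1n subn0.
Qed.

Lemma orbit_value_last (n m : nat) (j theta t : nat -> nat) :
  orbit_value n m j theta t n m = Ystar m t.
Proof.
rewrite /orbit_value addnC big_geq // add0n.
by apply: eq_bigr => k _; rewrite subnn expn0 mul1n.
Qed.

Lemma orbit_value_even (n m : nat) (j theta t : nat -> nat) (i p : nat) :
  i < n -> (forall k, p < k <= m -> i.+1 < j k) ->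
  orbit_value n m j theta t i p = (orbit_value n m j theta t i.+1 p).*2.
Proof.
move=> lin later; rewrite /orbit_value doubleD -!mul2n !big_distrr /=.
congr (_ + _); apply: eq_big_nat => k kP /=.
  by rewrite (_ : n - i = (n - i.+1).+1) ?expnS; lia.
have jk : i.+1 < j k by apply: later; lia.
by rewrite (_ : j k - 1 - i = (j k - 1 - i.+1).+1) ?expnS; lia.
Qed.

(** The term of index [p.+1] is due at this step: it leaves the second sum as
    [3 ^ p * theta p.+1] and enters the first one as [2 ^ (n - i.+1) * t p.+1],
    the hypothesis on [theta] and [t] accounting for the added 1. *)
Lemma orbit_value_odd (n m : nat) (j theta t : nat -> nat) (i p : nat) :
  i < n -> p < m -> j p.+1 = i.+1 ->
  (forall k, p.+1 < k <= m -> i.+1 < j k) ->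
  3 ^ p.+1 * theta p.+1 + 1 = 2 ^ (n - i) * t p.+1 ->
  3 * orbit_value n m j theta t i p + 1 =
    (orbit_value n m j theta t i.+1 p.+1).*2.
Proof.
move=> lin lpm jp later due; rewrite /orbit_value.
rewrite (big_ltn (_ : p.+1 < m.+1)) // (big_nat_recr p.+1) //=.
rewrite jp subn1 /= subnn subnn !expn0 !muln1.
have pow2 : 2 ^ (n - i) = 2 * 2 ^ (n - i.+1).
  by rewrite -expnS; congr (_ ^ _); lia.
have past : 3 * (\sum_(1 <= k < p.+1) 2 ^ (n - i) * 3 ^ (p - k) * t k) =
    2 * (\sum_(1 <= k < p.+1) 2 ^ (n - i.+1) * 3 ^ (p.+1 - k) * t k).
  rewrite !big_distrr; apply: eq_big_nat => k kP /=.
  by rewrite pow2 (subSn (_ : k <= p)) ?expnS; lia.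
have future :
    3 * (\sum_(p.+2 <= k < m.+1) 3 ^ p * 2 ^ (j k - 1 - i) * theta k) =
    2 * (\sum_(p.+2 <= k < m.+1) 3 ^ p.+1 * 2 ^ (j k - 1 - i.+1) * theta k).
  rewrite !big_distrr; apply: eq_big_nat => k kP /=.
  have jk : i.+1 < j k by apply: later; lia.
  by rewrite (_ : j k - 1 - i = (j k - 1 - i.+1).+1) ?expnS; lia.
rewrite -mul2n !mulnDr past future.
by move: due; rewrite pow2 expnS; lia.
Qed.

(** The equation [(j k <= i) = (k <= p)] says that [p] is the number of ones
    among the first [i] entries of [v]. *)
Lemma orbit_value_step (n m : nat) (v : n.-tuple bool) (j theta t : nat -> nat)
    (i p : nat) :
  ones_positions m v j ->
  (forall k, 1 <= k <= m ->
     3 ^ k * theta k + 1 = 2 ^ (n - j k + 1) * t k) ->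
  i < n -> p <= m -> (forall k, 1 <= k <= m -> (j k <= i) = (k <= p)) ->
  let N := orbit_value n m j theta t i p in
  odd N = nth false v i /\
  exists p', [/\ p' <= m,
    forall k, 1 <= k <= m -> (j k <= i.+1) = (k <= p')
    & collatz N = orbit_value n m j theta t i.+1 p'].
Proof.
move=> jv htheta lin lpm split_i N; have [_ jP jlt] := jv.
case vi : (nth false v i); last first.
  have later k : p < k <= m -> i.+1 < j k.
    move=> kP; have := split_i k; have [|_ vk] := jP k; first by lia.
    (* [j k = i.+1] would make entry [i] of [v] a one *)
    have : j k <> i.+1 by move=> jk; move: vk; rewrite jk subn1 /= vi.
    by lia.
  have NE := orbit_value_even _ _ _ theta t _ _ lin later.
  split; first by rewrite /N NE odd_double.
  exists p; split=> // [k km|]; last exact: collatz_even NE.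
  by have := split_i k km; have := later k; lia.
have [k0 k0m jk0] := ones_positions_surj _ _ _ _ _ jv lin vi.
have pk0 : p < k0 by have := split_i k0 k0m; lia.
have k0E : k0 = p.+1.
  (* an earlier index after [p] would have its position strictly between
     [i] and [i.+1] *)
  case: (ltngtP k0 p.+1) => // [|lt]; first by lia.
  have : j p.+1 < j k0 by apply: jlt; lia.
  by have := split_i p.+1; lia.
rewrite k0E in jk0 k0m.
have later k : p.+1 < k <= m -> i.+1 < j k.
  by move=> kP; rewrite -jk0; apply: jlt; lia.
have due := htheta _ k0m.
rewrite jk0 (_ : n - i.+1 + 1 = n - i) in due; last by lia.
have lpm' : p < m by lia.
have NE := orbit_value_odd _ _ _ _ _ _ _ lin lpm' jk0 later due.
split; first exact: odd_of_collatz_odd NE.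
exists p.+1; split=> // [k km|]; last exact: collatz_odd NE.
case: (ltngtP k p.+1) => kp; last by rewrite kp jk0 leqnn.
  by have := split_i k km; lia.
by have := later k; lia.
Qed.

Lemma collatz_orbit (n m : nat) (v : n.-tuple bool) (j theta t : nat -> nat)
    (i : nat) :
  ones_positions m v j ->
  (forall k, 1 <= k <= m ->
     3 ^ k * theta k + 1 = 2 ^ (n - j k + 1) * t k) ->
  i <= n ->
  exists p, [/\ p <= m, forall k, 1 <= k <= m -> (j k <= i) = (k <= p)
    & iter i collatz (Xstar m j theta) = orbit_value n m j theta t i p].
Proof.
move=> jv htheta; elim: i => [_|i IH lin].
  exists 0; split=> // [k km|]; last by rewrite orbit_value0.
  by case: jv => _ /(_ k km)[jk _] _; lia.
have [p [lpm split_i iE]] := IH (ltnW lin).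
have [_ [p' [? ? step]]] :=
  orbit_value_step _ _ _ _ _ _ _ _ jv htheta lin lpm split_i.
by exists p'; split=> //; rewrite iterS iE.
Qed.

Theorem theorem4p9 (n m : nat) (hn : 1 <= n) (hm : 1 <= m)
    (v : n.-tuple bool) (j : nat -> nat) (hj : ones_positions m v j)
    (theta t : nat -> nat)
    (theta_pos : forall k, 1 <= k <= m -> 0 < theta k)
    (t_pos : forall k, 1 <= k <= m -> 0 < t k)
    (htheta : forall k, 1 <= k <= m ->
       3 ^ k * theta k + 1 = 2 ^ (n - j k + 1) * t k) :
  [/\ parity_vector n (Xstar m j theta) = v,
      forall k, 1 <= k <= m -> odd (theta k)
    & iter n collatz (Xstar m j theta) = Ystar m t].
Proof.
split.
- apply: eq_from_tnth => i; rewrite tnth_mktuple (tnth_nth false).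
  have [p [lpm split_i ->]] :=
    collatz_orbit _ _ _ _ _ _ _ hj htheta (ltnW (ltn_ord i)).
  by have [] := orbit_value_step _ _ _ _ _ _ _ _ hj htheta (ltn_ord i) lpm
    split_i.
- move=> k km; have /(congr1 odd) := htheta k km.
  by rewrite !addn1 /= !oddM !oddX orbT /=; case: odd.
- have [p [lpm split_n ->]] := collatz_orbit _ _ _ _ _ _ _ hj htheta (leqnn n).
  have [_ jP _] := hj; have [|jm _] := jP m; first by lia.
  (* every one has been met by time [n] *)
  have -> : p = m by have := split_n m; lia.
  exact: orbit_value_last.
Qed.
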